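(* Let $X_{[n]}$ be drawn from the stochastic block model with true parameter $(\alpha^*,\pi^* )$. Set $$M_n(\alpha,\pi)=\frac{1}{n(n-1)}\mathcal{L}_2(X_{[n]};\alpha,\pi),\qquad J_n(\alpha,\pi)=\frac{1}{n(n-1)}\mathcal{J}(X_{[n]};\widehat\tau_{[n]},\alpha,\pi),$$ where $\mathcal{L}_2$ is the log-likelihood, $\mathcal{J}$ the variational log-likelihood and $\widehat\tau_{[n]}=\widehat\tau_{[n]}(\pi,\alpha)=\operatorname{argmax}_{\tau_{[n]}\in\mathcal{S}_n}\mathcal{J}(X_{[n]};\tau_{[n]},\alpha,\pi)$ (see context). Then, under (A2) and (A3), $$\sup_{\alpha,\pi}\left|J_n(\alpha,\pi)-M_n(\alpha,\pi)\right|=o(1)\qquad\mathbb{P}\text{-a.s.},$$ where the supremum is over the $(\alpha,\pi)$ fulfilling (A2) and (A3).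
   Context: Stochastic block model (SBM): $Q$ is fixed and known. With parameters $(\alpha,\pi)$, where $\alpha$ is a probability vector in $(0,1)^Q$ and $\pi\in[0,1]^{Q\times Q}$, the labels $Z=(Z_i)_{i\geq1}$ are i.i.d. with $\mathbb{P}(Z_i=q)=\alpha_q$; given $Z$, the $X_{i,j}$, $i\neq j$, are independent Bernoulli$(\pi_{Z_i,Z_j})$, and $X_{i,i}=0$. $X_{[n]}=(X_{i,j})_{1\leq i,j\leq n}$. $\mathbb{P}$ is the law under $(\alpha^*,\pi^* )$. Log-likelihoods: $\mathcal{L}_1(X_{[n]};z_{[n]},\pi)=\sum_{i\neq j}\{X_{i,j}\log\pi_{z_i,z_j}+(1-X_{i,j})\log(1-\pi_{z_i,z_j})\}$ for $z_{[n]}\in\{1,\ldots,Q\}^n$, and $\mathcal{L}_2(X_{[n]};\alpha,\pi)=\log\left(\sum_{z_{[n]}}e^{\mathcal{L}_1(X_{[n]};z_{[n]},\pi)}\prod_{i=1}^n\alpha_{z_i}\right)$. Variational log-likelihood: $\mathcal{S}_n$ is the set of $\tau_{[n]}=(\tau_{i,q})_{1\leq i\leq n,1\leq q\leq Q}$ with $\tau_{i,q}\in[0,1]$ and $\sum_q\tau_{i,q}=1$ for every $i$; $D_{\tau_{[n]}}(z_{[n]})=\prod_i\tau_{i,z_i}$. Then $\mathcal{J}(X_{[n]};\tau_{[n]},\alpha,\pi)=\mathcal{L}_2(X_{[n]};\alpha,\pi)-K(D_{\tau_{[n]}},P^{X_{[n]}})$, with $K$ the Kullback–Leibler divergence and $P^{X_{[n]}}$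 the posterior distribution of $Z_{[n]}$ given $X_{[n]}$ under $(\alpha,\pi)$; equivalently $\mathcal{J}(X_{[n]};\tau_{[n]},\alpha,\pi)=\sum_{i\neq j}\sum_{q,l}[X_{i,j}\log\pi_{q,l}+(1-X_{i,j})\log(1-\pi_{q,l})]\tau_{i,q}\tau_{j,l}-\sum_{i,q}\tau_{i,q}(\log\tau_{i,q}-\log\alpha_q)$. Conventions: $0\log0=0$, $0\cdot(-\infty)=0$, $e^{-\infty}=0$, $\log0=-\infty$, and $|(-\infty)-(-\infty)|=0$. (A2) for all $(q,l)$, $\pi_{q,l}\in(0,1)$ implies $\pi_{q,l}\in[\zeta,1-\zeta]$, with $\zeta>0$ a fixed constant not depending on $n$. (A3) $\alpha_q\in[\gamma,1-\gamma]$ for all $q$, with $0<\gamma<1/Q$ a fixed constant not depending on $n$. *)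

(* Defs.v *)
From HB Require Import structures.
From mathcomp Require Import all_boot all_order all_algebra finmap.
From mathcomp Require Import all_classical all_reals all_analysis.
From mathcomp Require Import lra.

Set Implicit Arguments.
Unset Strict Implicit.
Unset Printing Implicit Defensive.

Import Order.TTheory GRing.Theory Num.Theory.
Import numFieldNormedType.Exports.

Local Open Scope classical_set_scope.
Local Open Scope ring_scope.

(* Classes are 'I_Q and nodes are numbered from 0, so X_[n] is an n x n boolean
   matrix and z_[n] a finite function from 'I_n to 'I_Q. *)

Section ParamSet.
Variables (R : realType) (Q : nat).

Definition sbm_param (al : 'I_Q -> R) (pp : 'M[R]_Q) : Prop :=
  [/\ forall q, 0 < al q < 1,
      \sum_q al q = 1 &
      forall q l, 0 <= pp q l <= 1].

Definition A2 (zeta : R) (pp : 'M[R]_Q) : Prop :=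
  forall q l, 0 < pp q l < 1 -> zeta <= pp q l <= 1 - zeta.

Definition A3 (gamma : R) (al : 'I_Q -> R) : Prop :=
  forall q, gamma <= al q <= 1 - gamma.

Definition param_set (zeta gamma : R) : set (('I_Q -> R) * 'M[R]_Q) :=
  [set th | [/\ sbm_param th.1 th.2, A2 zeta th.2 & A3 gamma th.1]].

End ParamSet.

Section Model.
Variables (R : realType) (d : measure_display) (T : measurableType d).
Variables (P : probability T R) (Q : nat).
Variables (al : 'I_Q -> R) (pp : 'M[R]_Q).
Variables (Z : nat -> T -> 'I_Q) (X : nat -> nat -> T -> bool).

Definition label_sigma : set (set T) :=
  <<s [set B | exists i q, B = Z i @^-1` [set q]] >>.

(* All variables take finitely many values, so independence is stated on
   elementary events. The last clause says that the conditional probability,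
   given sigma(Z), of prescribing the values x i j at finitely many
   off-diagonal positions is the product of the Bernoulli(pp (Z i) (Z j))
   weights: that is, given Z, these X i j are independent with those laws. *)
Record is_sbm : Prop := IsSbm {
  sbm_labels_measurable : forall i q, measurable (Z i @^-1` [set q]);
  sbm_edges_measurable : forall i j, measurable [set w | X i j w];
  sbm_labels_law : forall i q, P (Z i @^-1` [set q]) = (al q)%:E;
  sbm_labels_indep : forall (I : {fset nat}) (z : nat -> 'I_Q),
    P (\bigcap_(i in [set` I]) Z i @^-1` [set z i]) =
    (\prod_(i <- I) P (Z i @^-1` [set z i]))%E;
  sbm_diag : forall i w, X i i w = false;
  sbm_edges_given_labels :
    forall (B : set T) (I : {fset nat * nat}) (x : nat -> nat -> bool),
    label_sigma B -> (forall i, (i, i) \notin I) ->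
    P (B `&` \bigcap_(e in [set` I]) X e.1 e.2 @^-1` [set x e.1 e.2]) =
    (\int[P]_(w in B)
       (\prod_(e <- I) bernoulli_pmf (pp (Z e.1 w) (Z e.2 w)) (x e.1 e.2))%:E)%E
}.

Definition adjacency (n : nat) (w : T) : 'M[bool]_n := \matrix_(i, j) X i j w.

End Model.

Section Likelihoods.
Variables (R : realType) (Q n : nat).
Implicit Types (x : 'M[bool]_n) (z : {ffun 'I_n -> 'I_Q}).
Implicit Types (al : 'I_Q -> R) (pp : 'M[R]_Q) (tau : 'M[R]_(n, Q)).

(* [lne 0 = -oo], [expeR -oo = 0] and [0 * -oo = 0] in [\bar R]. *)
Definition L1 x z pp : \bar R :=
  (\sum_(i < n) \sum_(j < n | i != j)
     ((x i j)%:R%:E * lne (pp (z i) (z j))%:E +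
      (1 - (x i j)%:R)%:E * lne (1 - pp (z i) (z j))%:E))%E.

Definition L2 x al pp : \bar R :=
  lne (\sum_z expeR (L1 x z pp) * (\prod_(i < n) al (z i))%:E)%E.

Definition joint_pmf x al pp z : R :=
  (\prod_(i < n) al (z i)) *
  \prod_(i < n) \prod_(j < n | i != j)
     bernoulli_pmf (pp (z i) (z j)) (x i j).

(* If x has probability 0 under (al, pp), this is 0 for every z (division by 0)
   and no posterior exists. Then [L2 x al pp = -oo], so that [Jvar] below is
   -oo for every tau, which is also the value of its explicit expression. *)
Definition posterior x al pp z : R :=
  joint_pmf x al pp z / \sum_z' joint_pmf x al pp z'.

Definition simplex_rows : set 'M[R]_(n, Q) :=
  [set tau | (forall i q, 0 <= tau i q <= 1) /\
             (forall i, \sum_q tau i q = 1)].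

Definition D_of tau z : R := \prod_(i < n) tau i (z i).

(* A term with [p i = 0] is 0, and one with [p i > 0 = q i] is +oo. *)
Definition KL (I : finType) (p q : I -> R) : \bar R :=
  (\sum_i (p i)%:E * (lne (p i)%:E - lne (q i)%:E))%E.

Definition Jvar x tau al pp : \bar R :=
  (L2 x al pp - KL (D_of tau) (posterior x al pp))%E.

Definition is_argmax_Jvar x al pp tau : Prop :=
  simplex_rows tau /\
  forall tau', simplex_rows tau' -> (Jvar x tau' al pp <= Jvar x tau al pp)%E.

Definition M_crit x al pp : \bar R :=
  ((n * n.-1)%:R^-1%:E * L2 x al pp)%E.

Definition J_crit x tau al pp : \bar R :=
  ((n * n.-1)%:R^-1%:E * Jvar x tau al pp)%E.

End Likelihoods.

(* In [\bar R], -oo - -oo = -oo and its absolute value is +oo, whereas the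
   intended convention is |(-oo) - (-oo)| = 0. *)
Definition abs_diff (R : realType) (a b : \bar R) : \bar R :=
  (if (a == -oo) && (b == -oo) then 0 else `|a - b|)%E.

Section EntropyContinuity.
Variable R : realType.

Lemma xlnx_bound (x : R) : 0 < x < 1 -> `|x * ln x| <= 2 * Num.sqrt x.
Proof.
move=> /andP[x0 x1].
have s0 : 0 < Num.sqrt x by rewrite sqrtr_gt0.
have s2 : x = Num.sqrt x * Num.sqrt x by rewrite -expr2 sqr_sqrtr// ltW.
have lnx : ln x = - 2 * ln (Num.sqrt x)^-1.
  by rewrite lnV ?posrE// {1}s2 lnM ?posrE//; lra.
have l1 : ln (Num.sqrt x)^-1 <= (Num.sqrt x)^-1.
  by apply/ltW/ln_sublinear; rewrite invr_gt0.
have l2 : 0 <= ln (Num.sqrt x)^-1.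
  by rewrite ln_ge0// invf_ge1// -[leRHS]sqrtr1 ler_wsqrtr// ltW.
rewrite normrM (gtr0_norm x0) lnx mulNr normrN ger0_norm; last by rewrite mulr_ge0.
rewrite {1}s2 mulrCA ler_pM2l// -mulrA ger_pMr//.
by apply: le_trans (ler_wpM2l (ltW s0) l1) _; rewrite divff ?gt_eqF.
Qed.

Lemma xlnx_continuous : continuous (fun x : R => x * ln x).
Proof.
move=> x; have [x0|x0|->] := ltgtP x 0.
- rewrite /continuous_at ln0 ?mulr0 ?ltW//; apply: cvg_near_cst.
  by near=> y; rewrite ln0 ?mulr0//; apply: ltW; near: y; exact: lt_nbhsl.
- by apply: continuousM; [exact: cvg_id|exact: continuous_ln].
- rewrite /continuous_at mul0r; apply/cvgr0Pnorm_le => e e0.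
  have d0 : 0 < Num.min 1 ((e / 2) ^+ 2) by rewrite lt_min ltr01 exprn_gt0 ?divr_gt0.
  near=> y.
  have [y0|y0] := leP y 0; first by rewrite ln0// mulr0 normr0 ltW.
  have yd : y < Num.min 1 ((e / 2) ^+ 2).
    by near: y; exact: lt_nbhsl.
  move: yd; rewrite lt_min => /andP[y1 ye].
  apply: le_trans (xlnx_bound _) _; first by rewrite y0.
  rewrite -ler_pdivlMl// mulrC -[leRHS]ger0_norm ?divr_ge0// ?ltW// -sqrtr_sqr.
  by rewrite ltr_sqrt// exprn_gt0// divr_gt0.
Unshelve. all: by end_near. Qed.
End EntropyContinuity.

(* Maximizers of Jvar exist, so that selections of maximizers do. *)
Section ArgmaxExists.
Variables (R : realType) (Q n : nat).

Lemma vec_mx_coord_continuous (i : 'I_n) (q : 'I_Q) :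
  continuous (fun v : 'rV[R]_(n * Q) => vec_mx v i q).
Proof.
rewrite (_ : (fun _ => _) = (fun v : 'rV[R]_(n * Q) => v ord0 (mxvec_index i q))).
  exact: coord_continuous.
by apply/funext => v; rewrite mxE.
Qed.

Lemma D_of_continuous (z : {ffun 'I_n -> 'I_Q}) :
  continuous (fun v : 'rV[R]_(n * Q) => D_of (vec_mx v) z).
Proof.
rewrite /D_of.
apply: (@continuous_big R _ *%R 1 xpredT (@mul_continuous R) _ (index_enum _)
  (fun i v => vec_mx v i (z i))).
by move=> i _; exact: vec_mx_coord_continuous.
Qed.

Lemma argmax_Jvar_exists (x : 'M[bool]_n) (al : 'I_Q -> R) (pp : 'M[R]_Q) :
  sbm_param al pp -> exists tau, is_argmax_Jvar x al pp tau.
Proof.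
move=> [_ al1 _].
have [q0 _] : exists q : 'I_Q, true.
  apply/existsP; apply: contraPT (oner_neq0 R) => /existsPn h.
  by rewrite -al1 big1 ?eqxx// => q; have := h q.
set p := posterior x al pp.
suff [tau [St tm]] : exists tau : 'M[R]_(n, Q), simplex_rows tau /\
    forall tau', simplex_rows tau' -> (KL (D_of tau) p <= KL (D_of tau') p)%E.
  by exists tau; split=> // tau' St'; rewrite /Jvar leeD2l// leeN2; exact: tm.
pose good (tau : 'M[R]_(n, Q)) := forall z, p z <= 0 -> D_of tau z = 0.
have D0 (tau : 'M[R]_(n, Q)) z : simplex_rows tau -> 0 <= D_of tau z.
  by move=> [t0 _]; apply: prodr_ge0 => i _; have /andP[] := t0 i (z i).
pose f (v : 'rV[R]_(n * Q)) : R :=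
  \sum_(z : {ffun 'I_n -> 'I_Q})
    (D_of (vec_mx v) z * ln (D_of (vec_mx v) z) - D_of (vec_mx v) z * ln (p z)).
have fc : continuous f.
  apply: (continuous_big (op := +%R)); first exact: add_continuous.
  move=> z _ v; apply: cvgB; first exact: nbhs_filter.
    exact: (cvg_comp (fun v : 'rV[R]_(n * Q) => D_of (vec_mx v) z)
      (fun y => y * ln y) (@D_of_continuous z v) (@xlnx_continuous R _)).
  by apply: cvgMr_tmp; [exact: nbhs_filter|exact: D_of_continuous].
have KLgood tau : simplex_rows tau -> good tau ->
    KL (D_of tau) p = (f (mxvec tau))%:E.
  move=> St gt; rewrite /KL /f -sumEFin; apply: eq_bigr => z _.
  rewrite mxvecK; have [Dz|Dz] := eqVneq (D_of tau z) 0.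
    by rewrite Dz mul0e !mul0r subrr.
  have Dp : 0 < D_of tau z by rewrite lt_neqAle eq_sym Dz D0.
  have pz : 0 < p z by rewrite ltNge; apply/negP => /gt /eqP; rewrite (negbTE Dz).
  by rewrite !lne_EFin// -EFinB -EFinM mulrBr.
have KLbad tau : simplex_rows tau -> ~ good tau -> KL (D_of tau) p = +oo%E.
  move=> St ngt.
  have noNy (z : {ffun 'I_n -> 'I_Q}) :
      ((D_of tau z)%:E * (lne (D_of tau z)%:E - lne (p z)%:E) != -oo)%E.
    have [->|Dz] := eqVneq (D_of tau z) 0; first by rewrite mul0e.
    have Dp : 0 < D_of tau z by rewrite lt_neqAle eq_sym Dz D0.
    rewrite lne_EFin//; have [pz|pz] := leP (p z) 0.
      by rewrite le0_lneNy ?lee_fin//= mulry gtr0_sg// mul1e.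
    by rewrite lne_EFin.
  have /existsNP[z /not_implyP[pz Dz]] := ngt.
  rewrite /KL; apply/esum_eqyP => //; exists z; split => //.
  have Dp : 0 < D_of tau z by rewrite lt_neqAle eq_sym D0// andbT; exact/eqP.
  by rewrite lne_EFin// le0_lneNy ?lee_fin//= mulry gtr0_sg// mul1e.
have [[tau0 [St0 g0]]|nogood] :=
    pselect (exists tau : 'M[R]_(n, Q), simplex_rows tau /\ good tau); last first.
  exists (\matrix_(i, q) (q == q0)%:R); split.
    split=> i; first by move=> q; rewrite mxE; case: eqP; rewrite ?lexx ?ler01.
    rewrite (bigD1 q0)//= mxE eqxx big1 ?addr0// => q /negbTE qq0.
    by rewrite mxE qq0.
  move=> tau' St'; rewrite [leRHS]KLbad ?leey// => g.
  by apply: nogood; exists tau'.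
pose A := [set v : 'rV[R]_(n * Q) | simplex_rows (vec_mx v : 'M[R]_(n, Q)) /\
                                     good (vec_mx v)].
have A0 : A !=set0 by exists (mxvec tau0); rewrite /A /= mxvecK.
have cA : compact A.
  have := @rV_compact R (n * Q) (fun=> `[0, 1]%classic) (fun=> @segment_compact R 0 1).
  move=> cbox; apply: subclosed_compact cbox _; last first.
    move=> v [[t01 _] _] k; case/mxvec_indexP: k => i q.
    by have := t01 i q; rewrite mxE /= in_itv.
  have cl (g : 'rV[R]_(n * Q) -> R) (B : set R) : continuous g -> closed B ->
      closed (g @^-1` B) by move=> cg; apply: preimage_closed => ? _; exact: cg.
  rewrite (_ : A = (\bigcap_(iq in [set: 'I_n * 'I_Q])
      (fun v : 'rV[R]_(n * Q) => vec_mx v iq.1 iq.2) @^-1` `[0, 1]%classic) `&`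
    (\bigcap_(i in [set: 'I_n])
      (fun v : 'rV[R]_(n * Q) => \sum_q vec_mx v i q) @^-1` [set 1]) `&`
    (\bigcap_(z in [set z | p z <= 0])
      (fun v : 'rV[R]_(n * Q) => D_of (vec_mx v) z) @^-1` [set 0])); last first.
    apply/seteqP; split => v.
      move=> [[t01 ts] g]; split; last by move=> z /g.
      split; last by move=> i _; exact: ts.
      by move=> [i q] _; rewrite /= in_itv; exact: t01.
    move=> [[t01 ts] g]; split; last by move=> z /g.
    split; last by move=> i; exact: ts.
    by move=> i q; have := t01 (i, q) Logic.I; rewrite /= in_itv.
  apply: closedI; [apply: closedI|]; apply: closed_bigI => i _; apply: cl.
  - exact: vec_mx_coord_continuous.
  - exact: itv_closed.
  - apply: (continuous_big (op := +%R)); first exact: add_continuous.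
    by move=> q _; exact: vec_mx_coord_continuous.
  - exact: closed_eq.
  - exact: D_of_continuous.
  - exact: closed_eq.
have [c /set_mem[cS cg] cmin] := EVT_min_rV A0 cA (continuous_subspaceT fc).
exists (vec_mx c); split=> // tau' St'.
have [g'|ng'] := pselect (good tau'); last by rewrite [leRHS]KLbad ?leey.
rewrite !KLgood// lee_fin vec_mxK; apply: cmin.
by rewrite inE /A /= mxvecK.
Qed.
End ArgmaxExists.

(* Main.v *)
Require Import Defs.
From mathcomp Require Import all_boot all_order all_algebra.
From mathcomp Require Import all_classical all_reals all_analysis.

Import Order.TTheory GRing.Theory Num.Theory.
Import numFieldNormedType.Exports.

Local Open Scope classical_set_scope.
Local Open Scope ring_scope.

(** The estimate is deterministic: it holds for every adjacency matrix [x].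
    Let [K] be the Kullback-Leibler divergence from the optimal product
    distribution to the posterior, so that the variational log-likelihood is
    [L2 - K].  Then [K >= 0] by Gibbs' inequality ([KL_ge0]).  The optimum does at least as well as the product distribution
    concentrated at a single labelling [z], whose divergence is
    [- ln (posterior z)] ([KL_point]).  Take for [z] a labelling of maximal
    conditional likelihood [f z = P(x | z)]:
    [[
      posterior z = al(z) f(z) / \sum_z' al(z') f(z') >= al(z) >= gamma ^ n
    ]]
    since the denominator is an average of values [f z' <= f z]
    ([posterior_mode_ge]).  Hence [0 <= K <= n * ln (gamma^-1)], and after
    division by [n (n - 1)] the difference is at most
    [ln (gamma^-1) / (n - 1)], uniformly in the parameters ([abs_diff_crit]).
    When [x] is impossible under the parameters, both criteria are [-oo]. *)

(** * Kullback-Leibler divergence on a finite type *)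

(** Gibbs' inequality: [ln t <= t - 1] at [t = q i / p i] bounds each term
    from below by [p i - q i]. *)
Lemma KL_ge0 (R : realType) (I : finType) (p q : I -> R) :
  (forall i, 0 <= p i) -> (forall i, 0 <= q i) ->
  \sum_i q i <= \sum_i p i -> (0 <= KL p q)%E.
Proof.
move=> p0 q0 qp; apply: (@le_trans _ _ (\sum_i (p i - q i)%:E)%E).
  by rewrite sumEFin lee_fin sumrB subr_ge0.
apply: lee_sum => i _.
have [->|pi] := eqVneq (p i) 0; first by rewrite mul0e lee_fin sub0r oppr_le0.
have {}pi : 0 < p i by rewrite lt_neqAle eq_sym pi p0.
rewrite (lne_EFin pi); have [qi|qi] := leP (q i) 0.
  by rewrite (@le0_lneNy _ (q i)%:E) ?lee_fin//= mulry gtr0_sg// mul1e leey.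
rewrite (lne_EFin qi) -EFinB -EFinM lee_fin.
have : ln (q i / p i) <= q i / p i - 1.
  rewrite -{1}(subrK 1 (q i / p i)) addrC; apply: le_ln1Dx.
  by rewrite ltrBrDr addNr divr_gt0.
rewrite ln_div ?posrE// => h.
have := ler_wpM2l (ltW pi) h.
by rewrite !mulrBr mulr1 mulrCA divff ?gt_eqF// mulr1 -lerN2 !opprB.
Qed.

Lemma KL_point (R : realType) (I : finType) (i : I) (q : I -> R) :
  KL (fun j => (j == i)%:R) q = (- lne (q i)%:E)%E.
Proof.
rewrite /KL (bigD1 i)// big1; last first.
  by move=> j /negbTE ->; rewrite mul0e.
rewrite eqxx mulr1n mul1e (lne_EFin ltr01) ln1 add0e; exact: adde0.
Qed.

(** * Product distributions on labellings *)

Section ProductDistributions.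
Context {R : realType} {Q n : nat}.
Implicit Types (tau : 'M[R]_(n, Q)) (z : {ffun 'I_n -> 'I_Q}).

Lemma sum_prod_labels (a : 'I_n -> 'I_Q -> R) :
  (forall i, \sum_q a i q = 1) ->
  \sum_(z : {ffun 'I_n -> 'I_Q}) \prod_i a i (z i) = 1.
Proof. by move=> a1; rewrite -bigA_distr_bigA big1. Qed.

Definition point_rows z : 'M[R]_(n, Q) := \matrix_(i, q) (q == z i)%:R.

Lemma simplex_point_rows z : simplex_rows (point_rows z).
Proof.
split=> i; first by move=> q; rewrite mxE; case: eqP; rewrite ?lexx ?ler01.
rewrite (bigD1 (z i))//= mxE eqxx big1 ?addr0// => q /negbTE qz.
by rewrite mxE qz.
Qed.

Lemma D_of_point_rows z : D_of (point_rows z) = fun z' => (z' == z)%:R.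
Proof.
apply/funext => z'; rewrite /D_of; have [->|] := eqVneq z' z.
  by rewrite big1// => i _; rewrite mxE eqxx.
move=> zz'; have [i zi] : exists i, z' i != z i.
  apply/existsP; apply: contraNT zz' => /existsPn h.
  by apply/eqP/ffunP => i; apply/eqP; have := h i; rewrite negbK.
by rewrite (bigD1 i)//= mxE (negbTE zi) mul0r.
Qed.

End ProductDistributions.

(** * Likelihood and posterior *)

Section Posterior.
Context {R : realType} {Q n : nat}.
Variables (x : 'M[bool]_n) (al : 'I_Q -> R) (pp : 'M[R]_Q).
Hypothesis par : sbm_param al pp.
Implicit Types z : {ffun 'I_n -> 'I_Q}.

Definition cond_pmf z : R :=
  \prod_(i < n) \prod_(j < n | i != j) bernoulli_pmf (pp (z i) (z j)) (x i j).

Let evidence : R := \sum_z joint_pmf x al pp z.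

Lemma cond_pmf_ge0 z : 0 <= cond_pmf z.
Proof.
have [_ _ pp01] := par.
apply: prodr_ge0 => i _; apply: prodr_ge0 => j _.
have /andP[p0 p1] := pp01 (z i) (z j).
by case: (x i j) => //=; rewrite subr_ge0.
Qed.

Lemma prod_label_gt0 z : 0 < \prod_(i < n) al (z i).
Proof.
have [al01 _ _] := par.
by apply: prodr_gt0 => i _; have /andP[] := al01 (z i).
Qed.

Lemma joint_pmf_ge0 z : 0 <= joint_pmf x al pp z.
Proof. by apply: mulr_ge0; [exact/ltW/prod_label_gt0|exact: cond_pmf_ge0]. Qed.

Lemma expeR_L1 z : expeR (L1 x z pp) = (cond_pmf z)%:E.
Proof.
have [_ _ pp01] := par.
have expeR_sum (I : Type) (r : seq I) (A : pred I) (F : I -> \bar R) :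
    expeR (\sum_(i <- r | A i) F i)%E = (\prod_(i <- r | A i) expeR (F i))%E.
  by apply: big_morph; [exact: expeRD|rewrite expeR0].
rewrite expeR_sum /cond_pmf -prodEFin; apply: eq_bigr => i _.
rewrite expeR_sum -prodEFin; apply: eq_bigr => j _.
have /andP[p0 p1] := pp01 (z i) (z j).
case: (x i j); rewrite /bernoulli_pmf ?mulr1n ?mulr0n.
  by rewrite subrr mul0e adde0 mul1e; apply/eqP; rewrite lneK_eq lee_fin.
rewrite subr0 mul0e add0e mul1e.
by apply/eqP; rewrite lneK_eq lee_fin subr_ge0.
Qed.

(** The evidence may vanish, in which case both sides are [-oo]. *)
Lemma L2E : L2 x al pp = lne evidence%:E.
Proof.
rewrite /L2 /evidence -sumEFin; congr lne; apply: eq_bigr => z _.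
by rewrite expeR_L1 -EFinM mulrC.
Qed.

(** In [\bar R], [-oo] absorbs every summand, so [L2 = -oo] alone decides the
    variational criterion. *)
Lemma Jvar_evidence0 tau : evidence <= 0 ->
  (L2 x al pp = -oo /\ Jvar x tau al pp = -oo)%E.
Proof.
move=> e0; have L2y : L2 x al pp = -oo%E by rewrite L2E le0_lneNy ?lee_fin.
by split=> //; rewrite /Jvar L2y addNye.
Qed.

Lemma posterior_ge0 z : 0 <= posterior x al pp z.
Proof.
by rewrite divr_ge0 ?joint_pmf_ge0// sumr_ge0// => z' _; exact: joint_pmf_ge0.
Qed.

Lemma sum_posterior : 0 < evidence -> \sum_z posterior x al pp z = 1.
Proof. by move=> e0; rewrite -mulr_suml divff// gt_eqF. Qed.

(** At a maximizer of the conditional likelihood, conditioning on [x] can only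
    increase the probability of the labelling, whose prior is at least
    [g ^+ n]. *)
Lemma posterior_mode_ge (g : R) : 0 < g -> (forall q, g <= al q) ->
  0 < evidence -> exists z, g ^+ n <= posterior x al pp z.
Proof.
move=> g0 gal e0; have [_ al1 _] := par.
have [z0 _] : exists z0 : {ffun 'I_n -> 'I_Q}, true.
  apply/existsP; apply: contraPT e0 => /existsPn h.
  by rewrite /evidence big1 ?ltxx// => z; have := h z.
have [z _ zmax] := @Order.TotalTheory.arg_maxP _ _ _ z0 xpredT cond_pmf isT.
exists z; rewrite ler_pdivlMr//.
have evle : evidence <= cond_pmf z.
  rewrite -[leRHS]mul1r -(@sum_prod_labels R Q n (fun=> al)) // mulr_suml.
  apply: ler_sum => z' _.
  by rewrite ler_wpM2l ?(ltW (prod_label_gt0 _))//; exact: zmax.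
apply: ler_pM => //; [exact/exprn_ge0/ltW|exact: ltW|].
rewrite -[n in g ^+ n]card_ord -prodr_const.
by apply: ler_prod => i _; rewrite (ltW g0) gal.
Qed.

Lemma KL_posterior_ge0 (tau : 'M[R]_(n, Q)) : simplex_rows tau ->
  0 < evidence -> (0 <= KL (D_of tau) (posterior x al pp))%E.
Proof.
move=> [t01 t1] e0; apply: KL_ge0; last 1 first.
- by rewrite sum_posterior// /D_of sum_prod_labels.
- by move=> z; apply: prodr_ge0 => i _; have /andP[] := t01 i (z i).
- exact: posterior_ge0.
Qed.

Lemma L2_fin_num : 0 < evidence -> L2 x al pp \is a fin_num.
Proof. by move=> e0; rewrite L2E lne_EFin. Qed.

(** When [L2] is finite, maximizing [Jvar] means minimizing the divergence to
    the posterior; the competitor is the point mass at the labelling of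
    [posterior_mode_ge]. *)
Lemma KL_argmax_le (g : R) (tau : 'M[R]_(n, Q)) : 0 < g ->
  (forall q, g <= al q) -> 0 < evidence -> is_argmax_Jvar x al pp tau ->
  (KL (D_of tau) (posterior x al pp) <= (ln g^-1 *+ n)%:E)%E.
Proof.
move=> g0 gal e0 [_ tmax].
have [z zge] := posterior_mode_ge g g0 gal e0.
have pz : 0 < posterior x al pp z by apply: lt_le_trans zge; exact: exprn_gt0.
have := tmax _ (simplex_point_rows z).
rewrite /Jvar leeD2lE ?L2_fin_num// leeN2 D_of_point_rows KL_point => h.
apply: le_trans h _; rewrite lne_EFin// lee_fin.
rewrite lnV ?posrE// mulNrn lerN2 -lnXn// ler_ln ?posrE//.
exact: exprn_gt0.
Qed.

End Posterior.

(** * Uniform comparison of the two criteria *)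

Lemma abs_diff_ge0 (R : realType) (a b : \bar R) : (0 <= abs_diff a b)%E.
Proof. by rewrite /abs_diff; case: ifP. Qed.

(** The two criteria differ by [K / (n (n - 1))], with [0 <= K <= n ln (gamma^-1)].
    The size is written [n.+2] to keep the normalization nonzero. *)
Lemma abs_diff_crit (R : realType) (Q n : nat) (zeta gamma : R)
    (th : ('I_Q -> R) * 'M[R]_Q) (x : 'M[bool]_n.+2) (tau : 'M[R]_(n.+2, Q)) :
  0 < gamma -> param_set zeta gamma th -> is_argmax_Jvar x th.1 th.2 tau ->
  (abs_diff (J_crit x tau th.1 th.2) (M_crit x th.1 th.2)
    <= (ln gamma^-1 / n.+1%:R)%:E)%E.
Proof.
move=> g0 [par _ A3th] tmax.
have gal q : gamma <= th.1 q by have /andP[] := A3th q.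
have gV : 0 <= ln gamma^-1.
  rewrite ln_ge0// invf_ge1//; have [al01 al1 _] := par.
  have [q _] : exists q : 'I_Q, true.
    apply/existsP; apply: contraPT (oner_neq0 R) => /existsPn h.
    by rewrite -al1 big1 ?eqxx// => q; have := h q.
  by apply: le_trans (gal q) _; have /andP[_ /ltW] := al01 q.
set c : R := (n.+2 * n.+1)%:R^-1.
have c0 : 0 < c by rewrite invr_gt0 ltr0n.
rewrite /abs_diff /J_crit /M_crit -/c /=.
have [e0|e0] := leP (\sum_z joint_pmf x th.1 th.2 z) 0.
  have [-> ->] := Jvar_evidence0 x _ _ par tau e0.
  rewrite mulrNy gtr0_sg// mul1e eqxx /=.
  by rewrite lee_fin divr_ge0.
have K0 := KL_posterior_ge0 x _ _ par tau tmax.1 e0.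
have Kn := KL_argmax_le x _ _ par gamma tau g0 gal e0 tmax.
have L2f := L2_fin_num x _ _ par e0.
have Kf : KL (D_of tau) (posterior x th.1 th.2) \is a fin_num.
  by rewrite ge0_fin_numE//; apply: le_lt_trans Kn _; rewrite ltry.
rewrite /Jvar; move: K0 Kn; rewrite -(fineK L2f) -(fineK Kf).
set k := fine _; set l := fine _; rewrite !lee_fin => k0 kn.
rewrite -mulrBr addrAC subrr sub0r mulrN normrN.
rewrite ger0_norm ?mulr_ge0//; last exact: ltW.
apply: le_trans (ler_wpM2l (ltW c0) kn) _.
rewrite -[ln _ *+ _]mulr_natr /c natrM invfM.
by rewrite mulrCA mulrAC mulVf ?mul1r ?pnatr_eq0.
Qed.

(** Uniform label probabilities satisfy (A3) because [gamma < Q^-1 <= 1/2], and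
    the zero connectivity matrix satisfies (A2) vacuously. *)
Lemma param_set_nonempty (R : realType) (Q : nat) (zeta gamma : R) :
  (1 < Q)%N -> 0 < gamma < Q%:R^-1 -> @param_set R Q zeta gamma !=set0.
Proof.
move=> Q1 /andP[g0 gQ]; have Q0 : 0 < Q%:R :> R by rewrite ltr0n ltnW.
have Qh : Q%:R^-1 <= 2^-1 :> R by rewrite lef_pV2 ?posrE// ler_nat.
exists (fun=> Q%:R^-1, 0); split => /=.
- split.
  + by move=> q; rewrite invr_gt0 Q0 invf_lt1// ltr1n.
  + by rewrite sumr_const card_ord -(mulr_natl Q%:R^-1) divff// gt_eqF.
  + by move=> q l; rewrite mxE lexx ler01.
- by move=> q l; rewrite mxE ltxx.
- move=> q; rewrite ltW//= lerBrDr [leRHS]splitr div1r lerD//.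
  exact: le_trans (ltW gQ) Qh.
Qed.

Lemma sbm_param_gt1 (R : realType) (Q : nat) (al : 'I_Q -> R) pp :
  sbm_param al pp -> (1 < Q)%N.
Proof.
case: Q al pp => [|[|//]] al pp [al01 al1 _]; exfalso; move: al1.
  by rewrite big_ord0 => /eqP; rewrite eq_sym oner_eq0.
by rewrite big_ord1 => al1; have := al01 ord0; rewrite al1 ltxx andbF.
Qed.

(** The bound of [abs_diff_crit] does not depend on the adjacency matrix, so
    the convergence holds along every sequence of matrices; the almost sure
    statement is its instance at each outcome. *)
Lemma cvg_sup_abs_diff (R : realType) (Q : nat) (zeta gamma : R)
    (x : forall n, 'M[bool]_n)
    (tau : forall n, ('I_Q -> R) -> 'M[R]_Q -> 'M[R]_(n, Q)) :
  (1 < Q)%N -> 0 < gamma < Q%:R^-1 ->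
  (forall n th, param_set zeta gamma th ->
     is_argmax_Jvar (x n) th.1 th.2 (tau n th.1 th.2)) ->
  (fun n => ereal_sup
     [set abs_diff (J_crit (x n) (tau n th.1 th.2) th.1 th.2)
                   (M_crit (x n) th.1 th.2)
     | th in @param_set R Q zeta gamma]) @ \oo --> 0%E.
Proof.
move=> Q1 gQ tmax; have /andP[g0 _] := gQ.
(* The supremum of the empty set is [-oo]: the lower bound [0] needs a point. *)
have [th0 pth0] := @param_set_nonempty R Q zeta gamma Q1 gQ.
set u := (X in X @ _ --> _).
have u_bound n : (0 <= u (n + 2)%N <= (ln gamma^-1 * harmonic n)%:E)%E.
  rewrite addn2; apply/andP; split.
    apply: le_ereal_sup_tmp; eexists; first by exists th0.
    exact: abs_diff_ge0.
  apply: ge_ereal_sup => _ [th pth <-].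
  by apply: abs_diff_crit; [|exact: pth|exact: tmax].
have bound0 : (ln gamma^-1 * harmonic n)%:E @[n --> \oo] --> 0%:E.
  apply: cvg_EFin; first exact: nearW.
  rewrite -(mulr0 (ln gamma^-1)).
  by apply: cvgMl_tmp; exact: cvg_harmonic.
(* The normalization [n (n - 1)] vanishes for [n < 2]. *)
rewrite -(cvg_shiftn 2).
exact: (squeeze_cvge (nearW eventually_filter u_bound)
  (@cvg_cst (\bar R) 0%E nat \oo eventually_filter) bound0).
Qed.

Theorem theorem4p2 (R : realType) (d : measure_display) (T : measurableType d)
  (P : probability T R) (Q : nat)
  (al_star : 'I_Q -> R) (pp_star : 'M[R]_Q)
  (hstar : sbm_param al_star pp_star)
  (Z : nat -> T -> 'I_Q) (X : nat -> nat -> T -> bool)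
  (hsbm : is_sbm P al_star pp_star Z X)
  (zeta gamma : R) (hzeta : 0 < zeta) (hgamma : 0 < gamma < Q%:R^-1)
  (tau_hat : forall n : nat,
     'M[bool]_n -> ('I_Q -> R) -> 'M[R]_Q -> 'M[R]_(n, Q))
  (htau : forall (n : nat) (x : 'M[bool]_n) (th : ('I_Q -> R) * 'M[R]_Q),
     param_set zeta gamma th ->
     is_argmax_Jvar x th.1 th.2 (tau_hat n x th.1 th.2)) :
  {ae P, forall w,
    (fun n : nat =>
       ereal_sup
         [set (let x := adjacency X n w in
               abs_diff (J_crit x (tau_hat n x th.1 th.2) th.1 th.2)
                        (M_crit x th.1 th.2))
         | th in @param_set R Q zeta gamma])
      @ \oo --> 0%E}.
Proof.
apply: aeW => w.
apply: (@cvg_sup_abs_diff R Q zeta gamma (fun n => adjacency X n w)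
  (fun n => tau_hat n (adjacency X n w))) => //; first exact: sbm_param_gt1 hstar.
by move=> n th; exact: htau.
Qed.
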